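(* For every integer $s\ge 3$, $m(3,s)\le \frac{73}{6}s^3+50$. Moreover, for every integer $s\ge 21$, $m(3,s)\le\frac{73}{6}s^3$.
   Context: $[n]=\{1,\dots,n\}$ and $\binom{[n]}{k}$ is the family of all $k$-element subsets of $[n]$; a family $\mathcal{F}\subset\binom{[n]}{k}$ is called a $k$-graph. The matching number $\nu(\mathcal{F})$ is the maximum number of pairwise disjoint members of $\mathcal{F}$. For $T\subset[n]$, $\mathcal{F}(\overline{T})=\{F\in\mathcal{F}: F\cap T=\emptyset\}$. A $k$-graph $\mathcal{F}\subset\binom{[n]}{k}$ is $t$-resilient if $\nu(\mathcal{F}(\overline{T}))=\nu(\mathcal{F})$ for every $T\subset[n]$ with $|T|\le t$. For positive integers $k,s$, $m(k,s)$ denotes the maximum of $|\mathcal{F}|$ over all $(k-1)$-resilient $k$-graphs $\mathcal{F}$ (on $[n]$, for any $n$) with $\nu(\mathcal{F})=s$. *)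

(* Defs.v *)
From mathcomp Require Import all_boot all_order all_algebra.

Set Implicit Arguments.
Unset Strict Implicit.
Unset Printing Implicit Defensive.

Section Families.

Variable V : finType.
Implicit Types (F M : {set {set V}}) (T A : {set V}).

Definition kgraph (k : nat) F : bool := [forall A in F, #|A| == k].

Definition matching_number F : nat :=
  \max_(M : {set {set V}} | (M \subset F) && trivIset M) #|M|.

Definition avoiding F T : {set {set V}} := [set A in F | [disjoint A & T]].

Definition resilient (t : nat) F : Prop :=
  forall T, #|T| <= t -> matching_number (avoiding F T) = matching_number F.

End Families.

(* The vertex set {1, ..., n} is represented by 'I_n = {0, ..., n-1}. *)
Definition admissible (k s n : nat) (F : {set {set 'I_n}}) : Prop :=
  [/\ kgraph k F, resilient k.-1 F & matching_number F = s].

(* [is_m k s v] says that m(k,s) = v. It is a relation because n is unbounded,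
   so that the existence of the maximum is not immediate; the two clauses
   determine v uniquely. *)
Definition is_m (k s v : nat) : Prop :=
  (exists (n : nat) (F : {set {set 'I_n}}), admissible k s F /\ #|F| = v) /\
  (forall (n : nat) (F : {set {set 'I_n}}), admissible k s F -> #|F| <= v).

(* Main.v *)
(* Write nu(F) = s and D = 3 s. Deleting a pair P does not decrease nu, so some
   matching of size s avoids P; its 3 s vertices meet every edge, hence P lies in
   at most D edges. Likewise a vertex lies in at most D^2 edges.

   Fix a maximum matching M with vertex set U, and call x in U heavy when more
   than 3 D edges meet U in x alone. Every edge of M has at most one heavy vertex.
   Let h be the number of heavy vertices. They lie in at most h D^2 edges. Among
   the edges avoiding them, let b_i be the number of those that meet U in i
   vertices.
   - If e in M has a heavy vertex, no edge meets U in exactly one other vertex of e;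
     otherwise the three vertices of e have pairwise cross-intersecting links
     outside U, which together have at most 3 D + 3 edges.
   - For e, f in M, three pairwise disjoint sets, each a heavy vertex of e or f or
     a pair between e and f lying in at least three edges that meet U nowhere else,
     extend to three disjoint edges, which could replace e and f in M. So few pairs
     between e and f lie in many edges, which bounds b_2.
   - Summing the codegrees of all pairs of non-heavy vertices of U bounds
     b_2 + 3 b_3.
   Combined, these estimates give |F| <= 11 s^3 + O(s^2), with lower-order terms
   small enough for every s >= 3. *)
Require Import Defs.
From mathcomp Require Import all_boot all_order all_algebra.
From mathcomp Require Import zify lra.
From Stdlib Require Import Classical.

Set Implicit Arguments.
Unset Strict Implicit.
Unset Printing Implicit Defensive.

(** * Matchings, the exchange argument, and covers obtained from resilience *)

Section SetFamilies.

Variable V : finType.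
Implicit Types (F L M N : {set {set V}}) (A B P S T e : {set V}).

Lemma leq_card_bigcup (I T : finType) (X : {set I}) (G : I -> {set T}) :
  #|\bigcup_(i in X) G i| <= \sum_(i in X) #|G i|.
Proof.
apply: (big_ind2 (fun (Y : {set T}) n => #|Y| <= n)) => [|Y m Z n hY hZ|//].
  by rewrite cards0.
by apply: leq_trans (leq_add hY hZ); rewrite cardsU leq_subr.
Qed.

Definition codeg F P : nat := #|[set A in F | P \subset A]|.

Lemma card_meet_le L S d :
    (forall w, w \in S -> codeg L [set w] <= d) ->
  #|[set A in L | ~~ [disjoint A & S]]| <= #|S| * d.
Proof.
move=> deg_le; rewrite -sum_nat_const.
apply: (@leq_trans #|\bigcup_(w in S) [set A in L | [set w] \subset A]|).
  apply/subset_leq_card/subsetP=> A; rewrite inE => /andP[AL].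
  case/pred0Pn=> w /andP[/= wA wS]; apply/bigcupP; exists w => //.
  by rewrite inE AL sub1set.
by apply: leq_trans (leq_card_bigcup _ _) _; apply: leq_sum.
Qed.

Lemma maximum_matching F :
  exists M, [/\ M \subset F, trivIset M & #|M| = matching_number F].
Proof.
have : 0 < #|[pred M : {set {set V}} | (M \subset F) && trivIset M]|.
  apply/card_gt0P; exists set0; rewrite inE sub0set.
  by apply/trivIsetP => A B; rewrite inE.
by case/(eq_bigmax_cond (fun M => #|M|)) => M /andP[? ?] eqM; exists M.
Qed.

Lemma matching_le F M :
  M \subset F -> trivIset M -> #|M| <= matching_number F.
Proof.
move=> sMF tM; pose Q (L : {set {set V}}) := (L \subset F) && trivIset L.
by apply: (@leq_bigmax_cond _ Q (fun L => #|L|)); rewrite /Q sMF.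
Qed.

(** [M :\: N :|: M'] is again a matching in [F]: the trace condition keeps [M'] off the members of
    [M :\: N]. As [F] lacks the empty set, the two families share no member and their sizes add
    up. *)
Lemma matching_exchange F M N M' :
    set0 \notin F -> M \subset F -> trivIset M -> #|M| = matching_number F ->
    N \subset M -> M' \subset F -> trivIset M' ->
    (forall A, A \in M' -> A :&: cover M \subset cover N) ->
  #|M'| <= #|N|.
Proof.
move=> F0 sMF tM maxM sNM sM'F tM' trace.
have N_disj B A : B \in M :\: N -> A \in M' -> [disjoint A & B].
  rewrite inE => /andP[BN BM] AM'; apply/pred0P=> x /=; apply/negP=> /andP[xA xB].
  have: x \in cover N.
    apply: (subsetP (trace A AM')); rewrite inE xA.
    by apply/bigcupP; exists B.
  case/bigcupP=> C CN xC.
  have CB : C != B by apply: contraNneq BN => <-.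
  have /pred0P/(_ x) := trivIsetP tM _ _ (subsetP sNM C CN) BM CB.
  by rewrite /= xC xB.
have disj : [disjoint M :\: N & M'].
  apply/pred0P=> B /=; apply/negP=> /andP[BMN BM'].
  have := N_disj _ _ BMN BM'; rewrite -setI_eq0 setIid => /eqP B0.
  by move: F0; rewrite -B0 (subsetP sM'F _ BM').
have tU : trivIset (M :\: N :|: M').
  apply/trivIsetP=> A B; rewrite !inE => /orP[A1|A2] /orP[B1|B2] AB.
  - by apply: (trivIsetP tM) => //; [case/andP: A1|case/andP: B1].
  - by rewrite disjoint_sym; apply: N_disj; rewrite ?inE.
  - by apply: N_disj; rewrite ?inE.
  - exact: (trivIsetP tM').
have sU : M :\: N :|: M' \subset F.
  by rewrite subUset sM'F andbT (subset_trans _ sMF) // subsetDl.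
have := matching_le sU tU; rewrite -maxM.
have [_] := leq_card_setU (M :\: N) M'; rewrite disj => /eqP ->.
by rewrite cardsD (setIidPr sNM); have := subset_leq_card sNM; lia.
Qed.

Lemma kgraphP k F A : kgraph k F -> A \in F -> #|A| = k.
Proof. by move=> /forallP/(_ A)/implyP h /h /eqP. Qed.

Lemma kgraph_notin0 k F : kgraph k.+1 F -> set0 \notin F.
Proof. by move=> kF; apply/negP=> /(kgraphP kF); rewrite cards0. Qed.

Lemma card_cover_matching k F M :
  kgraph k F -> M \subset F -> trivIset M -> #|cover M| = #|M| * k.
Proof.
move=> kF sMF /eqP <-; rewrite -sum_nat_const; apply: eq_bigr => A AM.
exact: kgraphP kF (subsetP sMF _ AM).
Qed.

Lemma meets_maximum_matching F M A : set0 \notin F ->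
    M \subset F -> trivIset M -> #|M| = matching_number F -> A \in F ->
  ~~ [disjoint A & cover M].
Proof.
move=> F0 sMF tM maxM AF; apply/negP=> dA.
suff: #|[set A]| <= #|@set0 {set V}| by rewrite cards1 cards0.
apply: (@matching_exchange F M) => //; rewrite ?sub0set ?sub1set //.
  by apply/trivIsetP=> B C /set1P-> /set1P->; rewrite eqxx.
move=> B /set1P->; move: dA; rewrite -setI_eq0 => /eqP->; exact: sub0set.
Qed.

(** [X] is the vertex set of a maximum matching of [avoiding F T]. By resilience this matching is
    also maximum in [F], so [X] meets even the edges that meet [T]. *)
Lemma resilient_cover k t F T : kgraph k.+1 F -> resilient t F -> #|T| <= t ->
  exists X : {set V}, [/\ #|X| <= matching_number F * k.+1, [disjoint T & X] &
     forall A, A \in F -> ~~ [disjoint A & X]].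
Proof.
move=> kF rF cT.
have [M [sM tM maxM]] := maximum_matching (avoiding F T).
have sMF : M \subset F.
  by apply: subset_trans sM _; apply/subsetP=> A; rewrite inE => /andP[].
exists (cover M); split.
- by rewrite (card_cover_matching kF) // maxM (rF T cT).
- apply/pred0P=> x /=; apply/negP=> /andP[xT /bigcupP[A AM xA]].
  move/subsetP/(_ A AM): sM; rewrite inE => /andP[_ /pred0P/(_ x)].
  by rewrite /= xA xT.
- move=> A; apply: meets_maximum_matching => //; first exact: kgraph_notin0 kF.
  by rewrite maxM rF.
Qed.

End SetFamilies.

(** * Degree bounds in a resilient 3-graph *)

Section Resilient3.

Variables (V : finType) (F : {set {set V}}).
Hypotheses (F3 : kgraph 3 F) (rF : resilient 2 F).
Let s := matching_number F.

Lemma codeg_pair (P : {set V}) : #|P| = 2 -> codeg F P <= s * 3.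
Proof.
move=> P2; have [X [cX dX mX]] := resilient_cover F3 rF (eq_leq P2).
apply: leq_trans cX; apply: leq_trans (leq_imset_card (fun z => z |: P) _).
apply/subset_leq_card/subsetP=> A; rewrite inE => /andP[AF PA].
have /pred0Pn[z /andP[/= zA zX]] := mX _ AF.
apply/imsetP; exists z => //; apply/eqP; rewrite eq_sym eqEcard.
have zP : z \notin P by apply/negP=> zP; move/pred0P/(_ z): dX; rewrite /= zP => /negP[].
by rewrite subUset sub1set zA PA cardsU1 zP P2 (kgraphP F3).
Qed.

Lemma codeg_vertex x : codeg F [set x] <= (s * 3) ^ 2.
Proof.
have x2 : #|[set x]| <= 2 by rewrite cards1.
have [X [cX dX mX]] := resilient_cover F3 rF x2.
rewrite expnS expn1; apply: leq_trans (leq_mul cX (leqnn _)).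
apply: (@leq_trans #|[set A in [set A in F | [set x] \subset A] |
                      ~~ [disjoint A & X]]|).
  by apply/subset_leq_card/subsetP=> A; rewrite !inE => /andP[AF ->]; rewrite AF mX.
apply: card_meet_le => w wX.
apply: leq_trans (codeg_pair (_ : #|[set x; w]| = 2)).
  apply/subset_leq_card/subsetP=> A; rewrite !inE !sub1set subUset !sub1set.
  by move=> /andP[/andP[-> ->] ->].
rewrite cards2; case: eqP => // xw.
by move/pred0P/(_ x): dX; rewrite /= inE xw eqxx => /negP[].
Qed.

End Resilient3.

(** * Cross-intersecting graphs of bounded degree *)

Section CrossIntersectingGraphs.

Variables (V : finType) (D : nat).
Implicit Types (L : {set {set V}}) (A B P Q : {set V}).

Definition cross_intersecting L L' :=
  forall A B, A \in L -> B \in L' -> ~~ [disjoint A & B].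

Lemma card_meets_two_edges L P Q : kgraph 2 L -> #|P| = 2 -> #|Q| = 2 ->
    [disjoint P & Q] ->
    (forall A, A \in L -> ~~ [disjoint A & P] && ~~ [disjoint A & Q]) ->
  #|L| <= 4.
Proof.
move=> L2 P2 Q2 PQ meet.
have -> : 4 = #|setX P Q| by rewrite cardsX P2 Q2.
apply: leq_trans (leq_imset_card (fun z => [set z.1; z.2]) _).
apply/subset_leq_card/subsetP=> A AL.
have /andP[/pred0Pn[x /andP[/= xA xP]] /pred0Pn[y /andP[/= yA yQ]]] := meet _ AL.
have xy : x != y.
  by apply/eqP=> xy; move/pred0P/(_ x): PQ; rewrite /= xP xy yQ.
apply/imsetP; exists (x, y); first by rewrite inE xP yQ.
apply/eqP; rewrite eq_sym eqEcard subUset !sub1set xA yA /=.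
by rewrite (kgraphP L2 AL) cards2 xy.
Qed.

Hypothesis D3 : 3 <= D.

(** An intersecting graph is a star, bounded by the degree, or lies in a triangle, bounded by
    [3 <= D]. *)
Lemma card_intersecting_graph L : kgraph 2 L ->
    (forall w, codeg L [set w] <= D) -> cross_intersecting L L -> #|L| <= D.
Proof.
move=> L2 degL iL.
have [->|[A AL]] := set_0Vmem L; first by rewrite cards0.
have /cards2P[p [q [pq defA]]] : #|A| == 2 by rewrite (kgraphP L2).
have star x : (forall B, B \in L -> x \in B) -> #|L| <= D.
  move=> xL; apply: leq_trans (degL x); apply/subset_leq_card/subsetP=> B BL.
  by rewrite inE BL sub1set xL.
(* If neither end of [A] is the centre of a star, some [B] misses [p] and some [C] misses [q]; then
   [A], [B], [C] are the sides of a triangle [p], [q], [r]. *)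
have [/forall_inP all_p|] := boolP [forall B in L, p \in B].
  exact: star all_p.
rewrite negb_forall_in => /exists_inP[B BL pB].
have [/forall_inP all_q|] := boolP [forall B in L, q \in B].
  exact: star all_q.
rewrite negb_forall_in => /exists_inP[C CL qC].
have /pred0Pn[r /andP[/= rB rC]] := iL _ _ BL CL.
have qB : q \in B.
  have /pred0Pn[x /andP[/= xA xB]] := iL _ _ AL BL.
  by move: xA xB pB; rewrite defA !inE => /orP[] /eqP-> // ->.
have pC : p \in C.
  have /pred0Pn[x /andP[/= xA xC]] := iL _ _ AL CL.
  by move: xA xC qC; rewrite defA !inE => /orP[] /eqP-> // ->.
have rp : r != p by apply: contraNneq pB => <-.
have rq : r != q by apply: contraNneq qC => <-.
have defB : B = [set q; r].
  apply/eqP; rewrite eq_sym eqEcard subUset !sub1set qB rB (kgraphP L2 BL).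
  by rewrite cards2 eq_sym rq.
have defC : C = [set p; r].
  apply/eqP; rewrite eq_sym eqEcard subUset !sub1set pC rC (kgraphP L2 CL).
  by rewrite cards2 eq_sym rp.
apply: leq_trans D3.
have T3 : #|[set p; q; r]| = 3 by rewrite setUC cardsU1 cards2 !inE pq (negPf rp) (negPf rq).
have <- : 'C(#|[set p; q; r]|, 2) = 3 by rewrite T3.
rewrite -cards_draws; apply/subset_leq_card/subsetP=> E EL.
rewrite inE (kgraphP L2 EL) eqxx andbT; apply/subsetP=> x xE.
(* If [E] left the triangle at [x], its only other vertex would lie on all three sides, which have
   no common vertex. *)
apply: contraT => xT.
have meet X : X \in L -> X \subset [set p; q; r] -> exists2 y, y \in E :\ x & y \in X.
  move=> XL XT; have /pred0Pn[y /andP[/= yE yX]] := iL _ _ EL XL.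
  exists y => //; rewrite !inE yE andbT; apply: contraNneq xT => <-.
  exact: (subsetP XT).
have /eqP/cards1P[y defE] : #|E :\ x| = 1.
  by apply/eqP; rewrite -eqSS -(kgraphP L2 EL) (cardsD1 x E) xE.
have in3 X : X \in L -> X \subset [set p; q; r] -> y \in X.
  by move=> XL XT; have [z] := meet X XL XT; rewrite defE => /set1P->.
have yA : y \in A by apply: in3 => //; rewrite defA; apply/subsetP=> z; rewrite !inE => ->.
have yB : y \in B.
  apply: in3 => //; rewrite defB; apply/subsetP=> z; rewrite !inE.
  by case/orP=> ->; rewrite ?orbT.
have yC : y \in C.
  apply: in3 => //; rewrite defC; apply/subsetP=> z; rewrite !inE.
  by case/orP=> ->; rewrite ?orbT.
move: yA; rewrite defA !inE => /orP[] /eqP yE; first by rewrite yE (negPf pB) in yB.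
by rewrite yE (negPf qC) in yC.
Qed.

(** First part: the two vertices of any member of [L'] meet all of [L]. Second part: either [L'] is
    intersecting, or two disjoint members of it leave only four transversal pairs for [L]. *)
Lemma card_cross_intersecting L L' : kgraph 2 L -> kgraph 2 L' ->
    (forall w, codeg L [set w] <= D) -> (forall w, codeg L' [set w] <= D) ->
    cross_intersecting L L' ->
  (#|L'| = 0 \/ #|L| <= 2 * D) /\ (#|L'| <= D \/ #|L| <= 4).
Proof.
move=> L2 L'2 degL degL' ix; split.
  have [->|[B BL']] := set_0Vmem L'; first by left; rewrite cards0.
  right; rewrite -(kgraphP L'2 BL').
  apply: leq_trans (card_meet_le (fun w _ => degL w)).
  by apply/subset_leq_card/subsetP=> A AL; rewrite inE AL ix.
have [/forall_inP int|] :=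
  boolP [forall A in L', [forall B in L', ~~ [disjoint A & B]]].
  left; apply: card_intersecting_graph => // A B AL BL.
  exact: (forall_inP (int A AL)).
rewrite negb_forall_in => /exists_inP[P PL'].
rewrite negb_forall_in => /exists_inP[Q QL']; rewrite negbK => PQ.
right; apply: (card_meets_two_edges L2 (kgraphP L'2 PL') (kgraphP L'2 QL') PQ).
by move=> A AL; rewrite !ix.
Qed.

(** If one graph exceeds [2 * D], the other two are empty. If one exceeds only [D], the others have
    at most 4 members each, and [2 * D + 8 <= 3 * D + 3] because [5 <= D]. Otherwise each has at
    most [D]. *)
Lemma sum_cross_intersecting L1 L2 L3 : 5 <= D ->
    (forall L, L \in [:: L1; L2; L3] ->
       [/\ kgraph 2 L, forall w, codeg L [set w] <= D & #|L| <= 3 * D]) ->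
    cross_intersecting L1 L2 -> cross_intersecting L1 L3 ->
    cross_intersecting L2 L3 ->
  #|L1| + #|L2| + #|L3| <= 3 * D + 3.
Proof.
move=> D5 hL i12 i13 i23.
have [|k1 d1 c1] := hL L1; first by rewrite !inE eqxx.
have [|k2 d2 c2] := hL L2; first by rewrite !inE eqxx orbT.
have [|k3 d3 c3] := hL L3; first by rewrite !inE eqxx !orbT.
have sym (L L' : {set {set V}}) : cross_intersecting L L' -> cross_intersecting L' L.
  by move=> i A B AL BL; rewrite disjoint_sym; apply: i.
have [] := card_cross_intersecting k1 k2 d1 d2 i12.
have [] := card_cross_intersecting k2 k1 d2 d1 (sym _ _ i12).
have [] := card_cross_intersecting k1 k3 d1 d3 i13.
have [] := card_cross_intersecting k3 k1 d3 d1 (sym _ _ i13).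
have [] := card_cross_intersecting k2 k3 d2 d3 i23.
have [] := card_cross_intersecting k3 k2 d3 d2 (sym _ _ i23).
by lia.
Qed.

End CrossIntersectingGraphs.

(** * Counting pairs inside edges *)

Section DoubleCounting.

Variable V : finType.

(** Both sides count edges together with an ordered pair of distinct vertices in [A :&: W]. *)
Lemma sum_ordered_pairs (L : {set {set V}}) (W : {set V}) :
  \sum_(u in W) \sum_(v in W | v != u) codeg L [set u; v] =
  \sum_(A in L) #|A :&: W| * #|A :&: W|.-1.
Proof.
have codegE u v : codeg L [set u; v] = \sum_(A in L) ((u \in A) && (v \in A)).
  rewrite /codeg -sum1_card [RHS]big_mkcond [LHS]big_mkcond /=.
  apply: eq_bigr => A _; rewrite !inE subUset !sub1set.
  by case: (A \in L) => //=; case: (_ && _).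
under eq_bigr => u _ do under eq_bigr => v _ do rewrite codegE.
under eq_bigr => u _ do rewrite exchange_big /=.
rewrite exchange_big /=; apply: eq_bigr => A _.
transitivity (\sum_(u in A :&: W) #|A :&: W|.-1); last by rewrite sum_nat_const.
rewrite [RHS]big_mkcond [LHS]big_mkcond /=; apply: eq_bigr => u _; rewrite inE.
case uW: (u \in W); last by rewrite andbF.
case uA: (u \in A) => /=; last by rewrite big1.
rewrite (cardsD1 u (A :&: W)) inE uA uW /= -sum1_card.
rewrite [RHS]big_mkcond [LHS]big_mkcond /=; apply: eq_bigr => v _; rewrite !inE.
by case: (v != u) => //=; case: (v \in A); case: (v \in W).
Qed.

Lemma card3_enum (e : {set V}) : #|e| = 3 -> exists x y z, enum e = [:: x; y; z].
Proof.
by rewrite cardE; case: (enum e) => [|x [|y [|z []]]] // _; exists x, y, z.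
Qed.

End DoubleCounting.

(** * Traces of edges on the vertex set [U] of a maximum matching *)

Section MaximumMatching.

Variables (V : finType) (F M : {set {set V}}) (D : nat).
Hypotheses (F3 : kgraph 3 F) (sMF : M \subset F) (tM : trivIset M).
Hypothesis maxM : #|M| = matching_number F.
Hypothesis codeg_le : forall P : {set V}, #|P| = 2 -> codeg F P <= D.
Hypothesis D5 : 5 <= D.
Implicit Types (A B S e f t : {set V}).

Let U := cover M.

Definition traced t := [set A in F | A :&: U == t].

(* An edge with trace [t] has [3 - #|t|] vertices outside [U]. The bound 4 lets three
   rich traces, taken by decreasing size, be extended greedily to disjoint edges. *)
Definition rich t := forall S, [disjoint S & U] -> #|S| + #|t| <= 4 ->
  exists2 A, A \in traced t & [disjoint A & S].

Definition heavy := [set u in U | 3 * D < #|traced [set u]|].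

Lemma tracedP t A : reflect (A \in F /\ A :&: U = t) (A \in traced t).
Proof. by rewrite inE; apply: (iffP andP) => [] [? /eqP]. Qed.

Lemma matching_card3 e : e \in M -> #|e| = 3.
Proof. by move=> /(subsetP sMF)/(kgraphP F3). Qed.

Lemma sub_matched e x : e \in M -> x \in e -> x \in U.
Proof. by move=> eM xe; apply/bigcupP; exists e. Qed.

Lemma traced_mem t A x : A \in traced t -> x \in U -> (x \in A) = (x \in t).
Proof. by case/tracedP=> _ <- xU; rewrite inE xU andbT. Qed.

Lemma traced_sub t A : A \in traced t -> t \subset A.
Proof. by case/tracedP=> _ <-; apply: subsetIl. Qed.

Lemma card_outside t A : A \in traced t -> #|A :\: U| + #|t| = 3.
Proof. by case/tracedP=> AF <-; rewrite addnC cardsID (kgraphP F3). Qed.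

Lemma disjoint_outside A : [disjoint A :\: U & U].
Proof. by apply/pred0P=> x; rewrite /= !inE; case: (x \in U); rewrite ?andbF. Qed.

Lemma disjoint_traced t t' A B : A \in traced t -> B \in traced t' ->
  [disjoint t & t'] -> [disjoint B & A :\: U] -> [disjoint A & B].
Proof.
move=> At Bt tt' BA; apply/pred0P=> x /=; apply/negP=> /andP[xA xB].
have [xU|xU] := boolP (x \in U).
  move/pred0P/(_ x): tt' => /=; rewrite -(traced_mem At xU) xA.
  by rewrite -(traced_mem Bt xU) xB.
by move/pred0P/(_ x): BA; rewrite /= inE xU xA xB.
Qed.

Lemma traced_exists c t S :
    (forall w, w \in S -> codeg (traced t) [set w] <= c) ->
    #|S| * c < #|traced t| ->
  exists2 A, A \in traced t & [disjoint A & S].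
Proof.
move=> degw; have [/exists_inP//|] := boolP [exists A in traced t, [disjoint A & S]].
rewrite negb_exists_in => /forall_inP meet.
rewrite ltnNge; case/negP; apply: leq_trans (card_meet_le degw).
by apply/subset_leq_card/subsetP=> A At; rewrite inE At meet.
Qed.

(** Here [S] has at most three vertices, each in at most [D] edges with [u], so more than [3 * D]
    edges leave one free of [S]. *)
Lemma rich_heavy u : u \in heavy -> rich [set u].
Proof.
rewrite inE => /andP[uU Qu] S SU; rewrite cards1 => S3.
apply: (@traced_exists D) => [w wS|]; last first.
  by apply: leq_ltn_trans Qu; rewrite leq_mul2r; apply/orP; right; lia.
apply: leq_trans (codeg_le (_ : #|[set u; w]| = 2)).
  apply/subset_leq_card/subsetP=> A; rewrite inE => /andP[At wA].
  have [AF _] := tracedP _ _ At.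
  by rewrite inE AF subUset wA (traced_sub At).
rewrite cards2; case: eqP => // uw.
by move/pred0P/(_ w): SU; rewrite /= wS -uw uU.
Qed.

(** Here [S] has at most two vertices, and each completes [t] to at most one edge. *)
Lemma rich_pair t : #|t| = 2 -> 2 < #|traced t| -> rich t.
Proof.
move=> t2 Qt S SU St; apply: (@traced_exists 1) => [w wS|]; last first.
  by apply: leq_ltn_trans Qt; lia.
rewrite /codeg -(cards1 (w |: t)); apply/subset_leq_card/subsetP=> A.
rewrite inE => /andP[At]; rewrite sub1set => wA.
have [AF eA] := tracedP _ _ At.
have wt : w \notin t.
  apply/negP; rewrite -eA inE => /andP[_ wU].
  by move/pred0P/(_ w): SU; rewrite /= wS wU.
rewrite inE eq_sym eqEcard subUset sub1set wA (traced_sub At).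
by rewrite cardsU1 wt t2 (kgraphP F3 AF).
Qed.

(** Two such edges, if disjoint, could replace [e] in [M]. *)
Lemma no_augmenting_pair e A B t t' : e \in M -> A \in traced t -> B \in traced t' ->
  t \subset e -> t' \subset e -> ~~ [disjoint A & B].
Proof.
move=> eM At Bt te t'e; apply/negP=> AB.
have F0 := kgraph_notin0 F3.
have [[AF eA] [BF eB]] := (tracedP _ _ At, tracedP _ _ Bt).
have neqAB : A != B.
  apply: contraNneq F0 => eqAB; move: AB.
  by rewrite -setI_eq0 -eqAB setIid => /eqP <-.
have := @matching_exchange _ F M [set e] [set A; B] F0 sMF tM maxM.
rewrite cards1 cards2 neqAB sub1set eM subUset !sub1set AF BF => X.
suff: 2 <= 1 by [].
apply: X => //.
  apply/trivIsetP=> X Y /set2P[]-> /set2P[]->; rewrite ?eqxx //.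
  by rewrite disjoint_sym.
by move=> X; rewrite /cover big_set1 => /set2P[]->; rewrite ?eA ?eB.
Qed.

(** Edges with these traces are chosen one by one, each avoiding the outer vertices of the earlier
    ones; they would replace [e] and [f]. An edge with trace [t] has [3 - #|t|] outer vertices, so
    the size hypotheses give the condition [#|S| + #|t| <= 4] of [rich] at each choice. *)
Lemma no_rich_triple e f t1 t2 t3 : e \in M -> f \in M ->
    rich t1 -> rich t2 -> rich t3 ->
    [disjoint t1 & t2] -> [disjoint t1 & t3] -> [disjoint t2 & t3] ->
    t1 \subset e :|: f -> t2 \subset e :|: f -> t3 \subset e :|: f ->
    #|t1| <= 4 -> #|t2| <= #|t1|.+1 -> #|t3|.+2 <= #|t1| + #|t2| ->
  False.
Proof.
move=> eM fM r1 r2 r3 d12 d13 d23 s1 s2 s3 c1 c2 c3.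
have F0 := kgraph_notin0 F3.
have [||A At _] := r1 set0; first by rewrite disjoints_subset sub0set.
  by rewrite cards0.
have oA := card_outside At.
have [||B Bt BA] := r2 (A :\: U); first exact: disjoint_outside.
  by move: #|A :\: U| #|t1| #|t2| oA c2 => a b c; clear; lia.
have oB := card_outside Bt.
have [||C Ct] := r3 ((A :|: B) :\: U); first exact: disjoint_outside.
  rewrite setDUl; move: (leq_card_setU (A :\: U) (B :\: U)).1.
  move: #|_ :|: _| #|A :\: U| #|B :\: U| #|t1| #|t2| #|t3| oA oB c3.
  by move=> ab a b c d g; clear; lia.
rewrite setDUl disjoint_sym disjoints_subset subUset -!disjoints_subset
  !(disjoint_sym _ C) => /andP[CA CB].
have AB := disjoint_traced At Bt d12 BA.
have AC := disjoint_traced At Ct d13 CA.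
have BC := disjoint_traced Bt Ct d23 CB.
have [[AF eA] [BF eB]] := (tracedP _ _ At, tracedP _ _ Bt).
have [CF eC] := tracedP _ _ Ct.
have neq (X Y : {set V}) : X \in F -> [disjoint X & Y] -> X != Y.
  move=> XF; apply: contraTneq => <-.
  by rewrite -setI_eq0 setIid; apply: contraNneq F0 => <-.
have : #|[set A; B; C]| <= #|[set e; f]|.
  apply: (matching_exchange F0 sMF tM maxM).
  - by rewrite subUset !sub1set eM fM.
  - by rewrite !subUset !sub1set AF BF CF.
  - apply/trivIsetP=> X Y; rewrite !inE -!orbA.
    by case/or3P=> /eqP-> /or3P[] /eqP->; rewrite ?eqxx // disjoint_sym.
  - have -> : cover [set e; f] = e :|: f.
      rewrite /cover; apply/setP=> x; apply/bigcupP/setUP => [[g /set2P[]-> xg]|].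
      + by left.
      + by right.
      + by case=> xg; [exists e|exists f]; rewrite ?set21 ?set22.
    by move=> X; rewrite !inE -!orbA => /or3P[] /eqP->; rewrite -/U ?eA ?eB ?eC.
have -> : #|[set A; B; C]| = 3.
  by rewrite setUC cardsU1 cards2 !inE !(eq_sym C) !negb_or !neq.
by rewrite cards2; case: (e != f).
Qed.

(** * Heavy vertices in a matching edge *)

Definition eta e := #|heavy :&: e|.

(** Such an [A] has two outer vertices; richness of [[set x]] yields an edge avoiding them, and the
    two edges contradict [no_augmenting_pair]. *)
Lemma heavy_excl e x y A : e \in M -> x \in e -> y \in e -> x \in heavy -> y != x ->
  A \notin traced [set y].
Proof.
move=> eM xe ye xH yx; apply/negP=> At.
have dyx : [disjoint [set y] & [set x]].
  by rewrite disjoints1 inE.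
have oA := card_outside At; rewrite cards1 in oA.
have [||B Bt BA] := rich_heavy xH (S := A :\: U); first exact: disjoint_outside.
  by rewrite cards1; move: #|_| oA => a; clear; lia.
have := disjoint_traced At Bt dyx BA.
by apply/negP/(no_augmenting_pair eM At Bt); rewrite sub1set.
Qed.

Lemma eta_le1 e : e \in M -> eta e <= 1.
Proof.
move=> eM; rewrite leqNgt; apply/negP=> /card_gt1P[x [y [] ]].
rewrite !inE => /andP[/andP[xU hx] xe] /andP[/andP[yU hy] ye] xy.
have xH : x \in heavy by rewrite inE xU.
have : traced [set y] != set0 by rewrite -card_gt0; apply: leq_trans hy.
rewrite eq_sym in xy.
by case/set0Pn=> A; rewrite (negPf (heavy_excl A eM xe ye xH xy)).
Qed.

Lemma etaP e : e \in M -> (eta e = 0 /\ [disjoint heavy & e]) \/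
  (eta e = 1 /\ exists x, [/\ x \in e, x \in heavy & forall y, y \in e -> y \in heavy -> y = x]).
Proof.
move=> eM; have := eta_le1 eM; rewrite leq_eqVlt ltnS leqn0 => /orP[h|h].
  right; split; first exact/eqP.
  have /cards1P[x ex] := h; exists x.
  have : x \in heavy :&: e by rewrite ex set11.
  rewrite inE => /andP[xH xe]; split=> // y ye yH; apply/set1P.
  by rewrite -ex inE yH ye.
by left; split; [exact/eqP|rewrite -setI_eq0 -cards_eq0].
Qed.

Lemma card_light e : e \in M -> #|[set u in e | u \notin heavy]| + eta e = 3.
Proof.
move=> eM; rewrite -(matching_card3 eM) -(cardsID heavy e) addnC setIC.
by congr (_ + _); apply: eq_card => u; rewrite !inE andbC.
Qed.


(** * Links outside [U], and edges meeting [U] in one vertex *)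

Definition link u := [set A :\ u | A in traced [set u]].

Lemma traced1_mem u A : A \in traced [set u] -> u \in A.
Proof. by move/traced_sub; rewrite sub1set. Qed.

Lemma link2 u : kgraph 2 (link u).
Proof.
apply/forall_inP=> B /imsetP[A At ->]; have [AF _] := tracedP _ _ At.
by rewrite -eqSS -(kgraphP F3 AF) (cardsD1 u A) (traced1_mem At).
Qed.

Lemma card_link u : #|link u| = #|traced [set u]|.
Proof.
apply: card_in_imset => A B At Bt eqAB.
by rewrite -(setD1K (traced1_mem At)) -(setD1K (traced1_mem Bt)) eqAB.
Qed.

Lemma codeg_link u w : codeg (link u) [set w] <= D.
Proof.
have [->|wu] := eqVneq w u.
  rewrite /codeg (_ : [set _ in _ | _] = set0) ?cards0 //.
  apply/setP=> B; rewrite !inE; apply/andP=> [[/imsetP[A _ ->]]].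
  by rewrite sub1set !inE eqxx.
apply: leq_trans (codeg_le (_ : #|[set u; w]| = 2)); last first.
  by rewrite cards2 eq_sym wu.
apply: leq_trans (leq_imset_card (fun A => A :\ u) _).
apply/subset_leq_card/subsetP=> B; rewrite inE => /andP[/imsetP[A At ->]].
rewrite sub1set => /setD1P[_ wA]; apply/imsetP; exists A => //.
have [AF _] := tracedP _ _ At.
by rewrite inE AF subUset !sub1set (traced1_mem At).
Qed.

(** The common vertex of the two edges is neither [u] nor [v], by their traces, so it survives in
    both links. *)
Lemma link_cross e u v : e \in M -> u \in e -> v \in e -> u != v ->
  cross_intersecting (link u) (link v).
Proof.
move=> eM ue ve uv X Y /imsetP[A At ->] /imsetP[B Bt ->].
have := no_augmenting_pair eM At Bt; rewrite !sub1set => /(_ ue ve).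
case/pred0Pn=> x /andP[/= xA xB]; apply/pred0Pn; exists x; rewrite /= !inE xA xB !andbT.
have uU := sub_matched eM ue; have vU := sub_matched eM ve.
apply/andP; split; [apply: contraTneq xB|apply: contraTneq xA] => ->.
  by rewrite (traced_mem Bt uU) inE.
by rewrite (traced_mem At vU) inE eq_sym.
Qed.

(** The term in [eta e] merges two cases: with a heavy vertex the sum vanishes by [heavy_excl];
    without one it is the total size of three cross-intersecting links. *)
Lemma sum_traced1 e : e \in M ->
  \sum_(u in e | u \notin heavy) #|traced [set u]| + (3 * D + 3) * eta e
    <= 3 * D + 3.
Proof.
move=> eM; have [[-> dH]|[-> [x [xe xH _]]]] := etaP eM; last first.
  rewrite big1 ?muln1 // => y /andP[ye yH]; apply/eqP; rewrite cards_eq0.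
  apply/set0Pn=> [[A At]]; have yx : y != x by apply: contraNneq yH => ->.
  by have := heavy_excl A eM xe ye xH yx; rewrite At.
rewrite muln0 addn0.
have eN u : u \in e -> u \notin heavy.
  by move=> ue; apply/negP=> uH; move/pred0P/(_ u): dH; rewrite /= uH ue.
rewrite (eq_bigl (mem e)) => [|u]; last by rewrite andb_idr //; apply: eN.
have [x [y [z def_e]]] := card3_enum (matching_card3 eM).
have e_uniq := enum_uniq e; rewrite def_e in e_uniq.
have mem_e u : (u \in e) = (u \in [:: x; y; z]) by rewrite -def_e mem_enum.
rewrite -big_enum def_e !big_cons big_nil /= addn0 -!card_link addnA.
have [xe ye ze] : [/\ x \in e, y \in e & z \in e].
  by rewrite !mem_e !inE !eqxx !orbT.
move: e_uniq; rewrite /= !inE negb_or andbT => /andP[/andP[xy xz] yz].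
apply: sum_cross_intersecting; rewrite ?D5 //; first exact: leq_trans D5.
- move=> L hL; have [u ue ->] : exists2 u, u \in e & L = link u.
    by move: hL; rewrite !inE => /or3P[] /eqP->; [exists x|exists y|exists z].
  split; [exact: link2|exact: codeg_link|rewrite card_link].
  by have := eN u ue; rewrite inE (sub_matched eM ue) -leqNgt.
- exact: (link_cross eM xe ye xy).
- exact: (link_cross eM xe ze xz).
- exact: (link_cross eM ye ze yz).
Qed.

(** * Edges meeting [U] in two vertices *)

Lemma traced2_le u v : u != v -> #|traced [set u; v]| <= D.
Proof.
move=> uv; apply: leq_trans (codeg_le (_ : #|[set u; v]| = 2)).
  apply/subset_leq_card/subsetP=> A At; rewrite inE (traced_sub At) andbT.
  by have [] := tracedP _ _ At.
by rewrite cards2 uv.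
Qed.

Lemma matched_neq e f u v : e \in M -> f \in M -> e != f -> u \in e -> v \in f -> u != v.
Proof.
move=> eM fM ef ue vf; apply/eqP=> uv.
by have /pred0P/(_ u) := trivIsetP tM _ _ eM fM ef; rewrite /= ue uv vf.
Qed.

(** The value 0 at heavy vertices lets sums run over all nine pairs of [e] and [f]. *)
Definition light_pair u v :=
  if (u \notin heavy) && (v \notin heavy) then #|traced [set u; v]| else 0.

(** A value above 2 makes its pair rich. If [e] and [f] contain k heavy vertices, at most 2 - k of
    the three pairs are of this kind; these give at most [D] each, the other pairs at most 2
    each. *)
Lemma sum_diagonal e f u0 u1 u2 v0 v1 v2 :
    e \in M -> f \in M -> e != f ->
    uniq [:: u0; u1; u2] -> uniq [:: v0; v1; v2] ->
    {subset [:: u0; u1; u2] <= e} -> {subset [:: v0; v1; v2] <= f} ->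
  light_pair u0 v0 + light_pair u1 v1 + light_pair u2 v2 + (eta e + eta f) * D
    <= 2 * D + 2 + 2 * (eta e + eta f).
Proof.
move=> eM fM ef uniq_u uniq_v se sf.
have neq u v : u \in e -> v \in f -> u != v by exact: matched_neq.
have leD u v : u \in e -> v \in f -> light_pair u v <= D.
  by move=> ue vf; rewrite /light_pair; case: ifP => // _; apply: traced2_le (neq _ _ ue vf).
have lightP u v : u \in e -> v \in f -> 2 < light_pair u v ->
    [/\ u \notin heavy, v \notin heavy, rich [set u; v], #|[set u; v]| = 2 &
        [set u; v] \subset e :|: f].
  move=> ue vf; rewrite /light_pair; case: ifP => // /andP[uH vH] r.
  have c2 : #|[set u; v]| = 2 by rewrite cards2 neq.
  split=> //; first exact: rich_pair.
  by rewrite subUset !sub1set !inE ue vf orbT.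
have disj2 u v u' v' : u \in e -> v \in f -> u' \in e -> v' \in f -> u != u' ->
    v != v' -> [disjoint [set u; v] & [set u'; v']].
  move=> ue vf u'e v'f uu' vv'; apply/pred0P=> x; rewrite /= !inE.
  apply/negP=> /andP[/orP[]/eqP-> /orP[]/eqP].
  - by apply/eqP.
  - by apply/eqP; apply: neq.
  - by apply/eqP; rewrite eq_sym; apply: neq.
  - by apply/eqP.
have disj1 u v x : u \notin heavy -> v \notin heavy -> x \in heavy ->
    [disjoint [set u; v] & [set x]].
  move=> uH vH xH; rewrite disjoint_sym disjoints1 !inE negb_or.
  by apply/andP; split; [apply: contraNneq uH|apply: contraNneq vH] => <-.
have heavyP g : g \in M -> g \subset e :|: f -> eta g = 0 \/
    eta g = 1 /\ exists x, [/\ x \in g, x \in heavy & [set x] \subset e :|: f].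
  move=> gM sg; have [[-> _]|[-> [x [xg xH _]]]] := etaP gM; [by left|right].
  by split=> //; exists x; rewrite sub1set (subsetP sg).
(* [one], [two] and [three] exclude rich triples with trace sizes 2, 1, 1, then 2, 2, 1, then 2, 2,
   2. *)
have one u v : u \in e -> v \in f -> 2 < light_pair u v -> eta e = 1 -> eta f = 1 -> False.
  move=> ue vf g3 e1 f1; have [uH vH r c2 s] := lightP _ _ ue vf g3.
  have [|[_ [x [xe xH sx]]]] := heavyP e eM (subsetUl _ _); first by rewrite e1.
  have [|[_ [y [yf yH sy]]]] := heavyP f fM (subsetUr _ _); first by rewrite f1.
  apply: (no_rich_triple eM fM r (rich_heavy xH) (rich_heavy yH)) => //.
  - exact: disj1.
  - exact: disj1.
  - by rewrite disjoints1 inE neq.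
  - by rewrite c2.
  - by rewrite c2 cards1.
  - by rewrite c2 !cards1.
have two u v u' v' : u \in e -> v \in f -> u' \in e -> v' \in f -> u != u' -> v != v' ->
    2 < light_pair u v -> 2 < light_pair u' v' -> eta e + eta f = 0.
  move=> ue vf u'e v'f uu' vv' g3 g3'.
  have [uH vH r c2 s] := lightP _ _ ue vf g3.
  have [u'H v'H r' c2' s'] := lightP _ _ u'e v'f g3'.
  have contra x : x \in heavy -> [set x] \subset e :|: f -> False.
    move=> xH sx; apply: (no_rich_triple eM fM r r' (rich_heavy xH)) => //.
    - exact: disj2.
    - exact: disj1.
    - exact: disj1.
    - by rewrite c2.
    - by rewrite c2 c2'.
    - by rewrite c2 c2' cards1.
  have [->|[_ [x [_ xH sx]]]] := heavyP e eM (subsetUl _ _); last by case: (contra x).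
  by have [->|[_ [x [_ xH sx]]]] := heavyP f fM (subsetUr _ _); last by case: (contra x).
have [u0e u1e u2e] : [/\ u0 \in e, u1 \in e & u2 \in e].
  by split; apply: se; rewrite !inE eqxx ?orbT.
have [v0f v1f v2f] : [/\ v0 \in f, v1 \in f & v2 \in f].
  by split; apply: sf; rewrite !inE eqxx ?orbT.
move: uniq_u uniq_v; rewrite /= !inE !negb_or !andbT.
move=> /andP[/andP[u01 u02] u12] /andP[/andP[v01 v02] v12].
have three : 2 < light_pair u0 v0 -> 2 < light_pair u1 v1 -> 2 < light_pair u2 v2 -> False.
  move=> g0 g1 g2.
  have [_ _ r0 c0 s0] := lightP _ _ u0e v0f g0.
  have [_ _ r1 c1 s1] := lightP _ _ u1e v1f g1.
  have [_ _ r2 c2 s2] := lightP _ _ u2e v2f g2.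
  apply: (no_rich_triple eM fM r0 r1 r2) => //; try exact: disj2.
  - by rewrite c0.
  - by rewrite c0 c1.
  - by rewrite c0 c1 c2.
have := eta_le1 eM; have := eta_le1 fM.
move: (leD _ _ u0e v0f) (leD _ _ u1e v1f) (leD _ _ u2e v2f) three.
move: (one _ _ u0e v0f) (one _ _ u1e v1f) (one _ _ u2e v2f).
move: (two _ _ _ _ u0e v0f u1e v1f u01 v01) (two _ _ _ _ u0e v0f u2e v2f u02 v02).
move: (two _ _ _ _ u1e v1f u2e v2f u12 v12) D5.
move: (eta e) (eta f) (light_pair u0 v0) (light_pair u1 v1) (light_pair u2 v2).
move: D; clear => d [|[|?]] [|[|?]] g0 g1 g2; rewrite ?ltnS ?ltn0 //; lia.
Qed.

(* The nine pairs of [e * f] split into three perfect matchings of [e] with [f]. *)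
Lemma sum_cross e f : e \in M -> f \in M -> e != f ->
  \sum_(u in e | u \notin heavy) \sum_(v in f | (v \notin heavy) && (v != u))
     #|traced [set u; v]| + 3 * (eta e + eta f) * D
    <= 6 * D + 6 + 6 * (eta e + eta f).
Proof.
move=> eM fM ef.
have -> : \sum_(u in e | u \notin heavy)
            \sum_(v in f | (v \notin heavy) && (v != u)) #|traced [set u; v]| =
          \sum_(u in e) \sum_(v in f) light_pair u v.
  rewrite big_mkcondr; apply: eq_bigr => u ue /=; rewrite /light_pair.
  case: (u \in heavy) => /=; first by rewrite big1.
  rewrite big_mkcondr; apply: eq_bigr => v vf /=.
  by rewrite eq_sym (matched_neq eM fM ef ue vf) andbT.
have [x [y [z def_e]]] := card3_enum (matching_card3 eM).
have [x' [y' [z' def_f]]] := card3_enum (matching_card3 fM).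
have e_uniq := enum_uniq e; have f_uniq := enum_uniq f.
rewrite def_e in e_uniq; rewrite def_f in f_uniq.
have se : {subset [:: x; y; z] <= e} by move=> u; rewrite -def_e mem_enum.
have sf : {subset [:: x'; y'; z'] <= f} by move=> u; rewrite -def_f mem_enum.
rewrite -big_enum def_e !big_cons big_nil /= -!big_enum def_f !big_cons !big_nil /=.
have uniq1 : uniq [:: y'; z'; x'] by rewrite -(rot_uniq 2).
have uniq2 : uniq [:: z'; x'; y'] by rewrite -(rot_uniq 1).
have sf1 : {subset [:: y'; z'; x'] <= f}.
  by move=> u; rewrite -(mem_rot 2); apply: sf.
have sf2 : {subset [:: z'; x'; y'] <= f}.
  by move=> u; rewrite -(mem_rot 1); apply: sf.
move: (sum_diagonal eM fM ef e_uniq f_uniq se sf).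
move: (sum_diagonal eM fM ef e_uniq uniq1 se sf1).
move: (sum_diagonal eM fM ef e_uniq uniq2 se sf2).
rewrite -mulnA; move: ((eta e + eta f) * D) (eta e + eta f) => a b.
by clear; lia.
Qed.

(** There are 6 ordered pairs of light vertices in [e] without a heavy vertex and 2 with one, a
    saving of [4 * D]. *)
Lemma sum_same e : e \in M ->
  \sum_(u in e | u \notin heavy) \sum_(v in e | (v \notin heavy) && (v != u))
     #|traced [set u; v]| + 4 * eta e * D <= 6 * D.
Proof.
move=> eM; set X := [set u in e | u \notin heavy].
have cX : #|X| + eta e = 3 by exact: card_light.
have le_u u : u \in e -> u \notin heavy ->
    \sum_(v in e | (v \notin heavy) && (v != u)) #|traced [set u; v]| <= #|X|.-1 * D.
  move=> ue uH; have -> : #|X|.-1 = #|X :\ u|.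
    by rewrite (cardsD1 u X) inE ue uH.
  rewrite -sum_nat_const.
  rewrite [leqRHS](eq_bigl
    (fun v => (v \in e) && ((v \notin heavy) && (v != u)))).
    by apply: leq_sum => v /andP[_ /andP[_ vu]]; rewrite traced2_le // eq_sym.
  by move=> v; rewrite in_setD1 in_set andbC andbA.
have : \sum_(u in e | u \notin heavy)
         \sum_(v in e | (v \notin heavy) && (v != u)) #|traced [set u; v]|
       <= #|X| * (#|X|.-1 * D).
  rewrite -sum_nat_const; rewrite [leqRHS](eq_bigl (fun v => (v \in e) && (v \notin heavy))).
    by apply: leq_sum => u /andP[ue uH]; apply: le_u.
  by move=> u; rewrite in_set.
have := eta_le1 eM; move: cX; move: #|X| (eta e) (bigop _ _ _) => n k S.
move: D; clear => d nk k1.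
have [[-> ->]|[-> ->]] : (n = 3 /\ k = 0) \/ (n = 2 /\ k = 1) by lia.
  by rewrite /=; lia.
by rewrite /=; lia.
Qed.

Lemma sum_eta : \sum_(e in M) eta e = #|heavy|.
Proof.
transitivity (\sum_(e in M) \sum_(u in e | u \in heavy) 1).
  apply: eq_bigr => e _; rewrite sum1_card; apply: eq_card => u.
  by rewrite in_setI andbC.
rewrite -(big_trivIset_cond _ tM) /= -sum1_card; apply: eq_bigl => u.
by rewrite andb_idl // inE => /andP[].
Qed.

(** The pairs are split by the matching edges containing them: [sum_same] bounds the blocks with
    [e = f], [sum_cross] the others. A heavy vertex is counted in [2 * #|M|.-1] ordered blocks with
    [e != f], which doubles the coefficients 3 and 6 of [sum_cross]. *)
Lemma sum_pairs :
  \sum_(u in U | u \notin heavy) \sum_(v in U | (v \notin heavy) && (v != u))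
     #|traced [set u; v]| + 4 * #|heavy| * D + 6 * (#|M|.-1 * #|heavy|) * D
    <= 6 * D * #|M| + #|M| * #|M|.-1 * (6 * D + 6) + 12 * (#|M|.-1 * #|heavy|).
Proof.
pose c e f := \sum_(u in e | u \notin heavy)
  \sum_(v in f | (v \notin heavy) && (v != u)) #|traced [set u; v]|.
have -> : \sum_(u in U | u \notin heavy) \sum_(v in U | (v \notin heavy) && (v != u))
     #|traced [set u; v]| = \sum_(e in M) \sum_(f in M) c e f.
  rewrite (big_trivIset_cond _ tM) /=; apply: eq_bigr => e _.
  rewrite [RHS]exchange_big /=; apply: eq_bigr => u _.
  by rewrite (big_trivIset_cond _ tM).
pose d e := c e e + \sum_(f in M | f != e) c e f.
have dE : \sum_(e in M) \sum_(f in M) c e f = \sum_(e in M) d e.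
  by apply: eq_bigr => e eM; rewrite (bigD1 e).
have cardM1 e : e \in M -> \sum_(f in M | f != e) 1 = #|M|.-1.
  move=> eM; rewrite sum1_card (cardsD1 e M) eM /=.
  by apply: eq_card => f; rewrite !inE andbC.
pose S e := \sum_(f in M | f != e) (eta e + eta f).
have SE e : e \in M -> S e + eta e = #|M|.-1 * eta e + #|heavy|.
  move=> eM; rewrite /S big_split /= -sum_eta (bigD1 e eM) /= -(cardM1 e eM).
  rewrite big_distrl /= -addnA [X in _ + X = _]addnC.
  by congr (_ + _); apply: eq_bigr => f _; rewrite mul1n.
have le_d e : e \in M ->
    d e + 4 * eta e * D + 3 * S e * D <= 6 * D + (#|M|.-1 * (6 * D + 6) + 6 * S e).
  move=> eM; have same := sum_same eM.
  have cross : \sum_(f in M | f != e) c e f + 3 * S e * D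
      <= #|M|.-1 * (6 * D + 6) + 6 * S e.
    rewrite -(cardM1 e eM) /S big_distrl big_distrr /= big_distrl big_distrr /=.
    rewrite -!big_split /=; apply: leq_sum => f /andP[fM fe].
    by rewrite mul1n; apply: sum_cross; rewrite // eq_sym.
  apply: leq_trans (leq_add same cross); rewrite /d -/(c e e).
  by move: (c e e) (bigop _ _ _) (S e) => p q r; clear; lia.
have : \sum_(e in M) (d e + 4 * eta e * D + 3 * S e * D)
    <= \sum_(e in M) (6 * D + (#|M|.-1 * (6 * D + 6) + 6 * S e)).
  exact: leq_sum.
have : \sum_(e in M) (S e + eta e) = \sum_(e in M) (#|M|.-1 * eta e + #|heavy|).
  exact: eq_bigr.
rewrite dE !big_split /= -!big_distrl /= -!big_distrr /= !sum_nat_const sum_eta.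
have : #|M| = 0 -> #|heavy| = 0.
  by move/cards0_eq=> M0; rewrite -sum_eta M0 big_set0.
move: (\sum_(e in M) d e) (\sum_(e in M) S e) #|M| #|heavy| => p q n h.
by move: D; clear => w; case: n => [/(_ erefl) ->|n _] /=; nia.
Qed.

(** The purely numerical conclusion leaves only arithmetic in four unknowns. *)
Lemma family_decomposition : (forall x, codeg F [set x] <= D ^ 2) ->
  exists h b1 b2 b3,
  [/\ h <= #|M|, #|F| <= h * D ^ 2 + (b1 + b2 + b3),
      b1 + (3 * D + 3) * h <= (3 * D + 3) * #|M|,
      2 * b2 + 4 * h * D + 6 * (#|M|.-1 * h) * D <=
        6 * D * #|M| + #|M| * #|M|.-1 * (6 * D + 6) + 12 * (#|M|.-1 * h) &
      2 * b2 + 6 * b3 <= (3 * #|M| - h) * (3 * #|M| - h).-1 * D].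
Proof.
move=> deg_le; have F0 := kgraph_notin0 F3.
pose F' := [set A in F | [disjoint A & heavy]].
pose B i := [set A in F' | #|A :&: U| == i].
pose W := U :\: heavy.
have WE u : (u \in W) = (u \in U) && (u \notin heavy) by rewrite in_setD andbC.
have sHU : heavy \subset U by apply/subsetP=> u; rewrite inE => /andP[].
have cardW : #|W| = 3 * #|M| - #|heavy|.
  by rewrite cardsD (setIidPr sHU) (card_cover_matching F3 sMF tM) mulnC.
have hM : #|heavy| <= #|M|.
  rewrite -sum_eta -[leqRHS]muln1 -sum_nat_const; apply: leq_sum => e.
  exact: eta_le1.
(* Edges of [F'] avoid heavy vertices, so their traces can be counted inside [W]. *)
have traceE A : A \in F' -> A :&: W = A :&: U.
  rewrite inE => /andP[_ /pred0P AH]; apply/setP=> x.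
  rewrite in_setI WE in_setI; have /= := AH x.
  by case: (x \in A) => //= ->; rewrite andbT.
exists #|heavy|, #|B 1|, #|B 2|, #|B 3|; split=> //.
- apply: (@leq_trans (#|[set A in F | ~~ [disjoint A & heavy]]| + #|F'|)).
    rewrite -(cardsID F' F) addnC leq_add //; apply/subset_leq_card/subsetP=> A.
      by rewrite !in_set => /andP[]; case: (A \in F).
    by rewrite in_setI => /andP[].
  apply: leq_add; first by apply: card_meet_le.
  apply: (@leq_trans #|B 1 :|: B 2 :|: B 3|).
    apply/subset_leq_card/subsetP=> A AF'; rewrite !in_setU.
    have AF : A \in F by move: AF'; rewrite in_set => /andP[].
    have : #|A :&: U| <= 3 by rewrite -(kgraphP F3 AF) subset_leq_card ?subsetIl.
    have : 0 < #|A :&: U|.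
      by rewrite card_gt0 setI_eq0 (meets_maximum_matching F0 sMF tM maxM AF).
    have BE i : (A \in B i) = (#|A :&: U| == i) by rewrite in_set AF'.
    by rewrite !BE; case: #|_| => [|[|[|[|]]]].
  apply: leq_trans (leq_card_setU _ _).1 _.
  by rewrite leq_add2r (leq_card_setU _ _).1.
- have sub1 : #|B 1| <= \sum_(u in U | u \notin heavy) #|traced [set u]|.
    rewrite -(eq_bigl _ _ WE); apply: leq_trans (leq_card_bigcup _ _).
    apply/subset_leq_card/subsetP=> A; rewrite in_set => /andP[AF'].
    rewrite -(traceE _ AF') => /cards1P[u eu]; apply/bigcupP; exists u.
      by apply/(subsetP (subsetIr A W)); rewrite eu set11.
    apply/tracedP; rewrite -traceE //; split=> //.
    by move: AF'; rewrite in_set => /andP[].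
  apply: (@leq_trans (\sum_(e in M) (\sum_(u in e | u \notin heavy) #|traced [set u]|
                       + (3 * D + 3) * eta e))).
    by rewrite big_split /= -big_distrr /= sum_eta -(big_trivIset_cond _ tM) leq_add2r.
  rewrite [leqRHS]mulnC -sum_nat_const; apply: leq_sum => e; exact: sum_traced1.
- have sub2 : 2 * #|B 2| <= \sum_(u in W) \sum_(v in W | v != u) codeg (B 2) [set u; v].
    rewrite sum_ordered_pairs mulnC -sum_nat_const; apply: leq_sum => A.
    by rewrite in_set => /andP[AF' /eqP]; rewrite -(traceE _ AF') => ->.
  apply: leq_trans sum_pairs; rewrite !leq_add2r; apply: leq_trans sub2 _.
  rewrite (eq_bigl _ _ WE); apply: leq_sum => u /andP[uU uH].
  rewrite [leqRHS](eq_bigl (fun v => (v \in W) && (v != u))); last first.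
    by move=> v; rewrite WE andbA.
  apply: leq_sum => v /andP[vW vu]; apply/subset_leq_card/subsetP=> A.
  rewrite !in_set -andbA => /andP[/andP[AF _] /andP[/eqP A2 uvA]]; rewrite AF /=.
  rewrite eq_sym eqEcard A2 cards2 eq_sym vu andbT subsetI uvA subUset !sub1set uU.
  by move: vW; rewrite WE => /andP[].
(* Each ordered pair in [W] has codegree at most [D], while an edge of [B 2] contains 2 such pairs
   and one of [B 3] contains 6. *)
- have : \sum_(u in W) \sum_(v in W | v != u) codeg F' [set u; v] <= #|W| * (#|W|.-1 * D).
    rewrite -sum_nat_const; apply: leq_sum => u uW.
    have -> : #|W|.-1 = #|W :\ u| by rewrite (cardsD1 u W) uW.
    rewrite -sum_nat_const [leqRHS](eq_bigl (fun v => (v \in W) && (v != u))).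
      apply: leq_sum => v /andP[_ vu].
      apply: leq_trans (codeg_le (_ : #|[set u; v]| = 2)).
        apply/subset_leq_card/subsetP=> A.
        by rewrite !in_set => /andP[/andP[-> _] ->].
      by rewrite cards2 eq_sym vu.
    by move=> v; rewrite in_setD1 andbC.
  rewrite -cardW -mulnA; apply: leq_trans; rewrite sum_ordered_pairs.
  have B23 : [disjoint B 2 & B 3].
    by apply/pred0P=> A /=; rewrite !in_set; case: (#|A :&: U| =P 2) => [->|]; rewrite ?andbF.
  apply: (@leq_trans (\sum_(A in B 2 :|: B 3) #|A :&: W| * #|A :&: W|.-1)).
    rewrite (eq_bigl [predU B 2 & B 3]) => [|A]; last by rewrite in_setU.
    rewrite bigU //= (eq_bigr (fun=> 2)) => [|A]; last first.
      by rewrite in_set => /andP[AF' /eqP]; rewrite -(traceE _ AF') => ->.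
    rewrite [X in _ <= _ + X](eq_bigr (fun=> 6)) => [|A]; last first.
      by rewrite in_set => /andP[AF' /eqP]; rewrite -(traceE _ AF') => ->.
    by rewrite !sum_nat_const ![_ * #|B _|]mulnC.
  rewrite [leqRHS](big_setID (B 2 :|: B 3)) /= (setIidPr _) ?leq_addr //.
  by apply/subsetP=> A; rewrite in_setU !in_set -andb_orr => /andP[].
Qed.

End MaximumMatching.

(* The bound is convex in [h], so only [h = 0] and [h = s] matter. *)
Lemma convex_bound s h b1 b2 b3 T : 3 <= s -> h <= s ->
    T <= h * (s * 3) ^ 2 + (b1 + b2 + b3) ->
    b1 + (3 * (s * 3) + 3) * h <= (3 * (s * 3) + 3) * s ->
    2 * b2 + 4 * h * (s * 3) + 6 * (s.-1 * h) * (s * 3) <=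
      6 * (s * 3) * s + s * s.-1 * (6 * (s * 3) + 6) + 12 * (s.-1 * h) ->
    2 * b2 + 6 * b3 <= (3 * s - h) * (3 * s - h).-1 * (s * 3) ->
  6 * T <= 73 * s ^ 3 + 300 /\ (21 <= s -> 6 * T <= 73 * s ^ 3).
Proof.
rewrite !expnS !expn0 !muln1 => s3 /subnKC; move: (s - h) => l es.
have -> : 3 * s - h = 2 * h + 3 * l by lia.
(* Products with truncated predecessors become variables tied by these equations, within reach of
   [lia]. *)
have eP : s.-1 * h + h = s * h by rewrite -mulSnr prednK // (leq_trans _ s3).
have eR : s * s.-1 + s = s * s by rewrite -mulnSr prednK // (leq_trans _ s3).
have eQ : (2 * h + 3 * l) * (2 * h + 3 * l).-1 + (2 * h + 3 * l) =
    (2 * h + 3 * l) * (2 * h + 3 * l) by rewrite -mulnSr prednK //; lia.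
move: (s.-1 * h) (s * s.-1) ((2 * h + 3 * l) * (2 * h + 3 * l).-1) eP eR eQ.
move=> P R Q eP eR eQ hT hb1 hb2 hb3.
have ePs : P * s + h * s = s * h * s by rewrite -mulnDl eP.
have eRs : R * s + s * s = s * s * s by rewrite -mulnDl eR.
have eQs : Q * s + (2 * h + 3 * l) * s = (2 * h + 3 * l) * (2 * h + 3 * l) * s.
  by rewrite -mulnDl eQ.
(* The [b1] bound is used six times, the next one twice, the last one once. The terms in h s^2
   cancel as 54 - 36 - 18, and the remaining 3 s h^2 is at most 3 s^2 h. *)
have main : 6 * T + h * (15 * s + 42) <=
    63 * (s * (s * s)) + 57 * (s * s) + 6 * s + h * (3 * (s * s)).
  by move: hT hb1 hb2 hb3 eP eR eQ ePs eRs eQs; rewrite -es; clear; lia.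
have hs : h <= s by rewrite -es leq_addr.
(* From 9 on, 66 s^3 + 57 s^2 + 6 s stays below 73 s^3. *)
have [s9|s9] := ltnP s 9; last first.
  have h3 : h * (3 * (s * s)) <= s * (3 * (s * s)) by rewrite leq_mul2r hs orbT.
  have s2 : 9 * (s * s) <= s * (s * s) by rewrite leq_mul2r s9 orbT.
  have s1 : 9 * s <= s * s by rewrite leq_mul2r s9 orbT.
  by split=> [|_]; lia.
(* For each smaller [s] the bound is linear in [h]. The constant 300 is spent here: the largest
   excess is 296, at [s = 4] and [h = 0]. *)
split=> [|s21]; last by lia.
move: main hs s3 s9; clear.
by do 9 (case: s => [|s]; first by lia); lia.
Qed.

Lemma admissible3_bound s n (F : {set {set 'I_n}}) : 3 <= s -> admissible 3 s F ->
  6 * #|F| <= 73 * s ^ 3 + 300 /\ (21 <= s -> 6 * #|F| <= 73 * s ^ 3).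
Proof.
move=> s3 [F3 rF nuF]; have [M [sMF tM maxM]] := maximum_matching F.
have D5 : 5 <= matching_number F * 3 by rewrite nuF; lia.
have [h [b1 [b2 [b3]]]] := family_decomposition F3 sMF tM maxM (codeg_pair F3 rF)
  D5 (codeg_vertex F3 rF).
by rewrite maxM nuF => -[hs hT hb1 hb2 hb3]; exact: convex_bound hT hb1 hb2 hb3.
Qed.

(** * Existence of the maximum *)

Lemma matching_of_triples (T : finType) m (X : {set T}) : 3 * m <= #|X| ->
  exists M : {set {set T}},
    [/\ trivIset M, #|M| = m & forall A, A \in M -> #|A| = 3 /\ A \subset X].
Proof.
elim: m X => [|m IH] X; first by exists set0; split=> [||A];
  rewrite ?cards0 ?inE //; apply/trivIsetP=> A B; rewrite inE.
rewrite mulnS => hX.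
have [A sAX A3] : exists2 A : {set T}, A \subset X & #|A| = 3.
  have : 0 < #|[set A : {set T} | A \subset X & #|A| == 3]|.
    by rewrite cards_draws bin_gt0 (leq_trans _ hX) ?leq_addr.
  by case/card_gt0P=> A; rewrite inE => /andP[sAX /eqP A3]; exists A.
have [|M [tM cM hM]] := IH (X :\: A).
  by rewrite cardsD (setIidPr sAX) A3 leq_subRL // (leq_trans _ hX) ?leq_addr.
have dA B : B \in M -> [disjoint A & B].
  move=> /hM[_]; rewrite subsetD => /andP[_].
  by rewrite disjoint_sym.
have A_M : A \notin M.
  apply/negP=> AM; have := dA A AM; rewrite -setI_eq0 setIid => /eqP A0.
  by move: A3; rewrite A0 cards0.
exists (A |: M); split.
- apply/trivIsetP=> B C /setU1P[->|BM] /setU1P[->|CM]; rewrite ?eqxx //.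
  + by move=> _; apply: dA.
  + by move=> _; rewrite disjoint_sym; apply: dA.
  + exact: (trivIsetP tM).
- by rewrite cardsU1 A_M cM.
- move=> B /setU1P[->//|/hM[B3]]; rewrite subsetD => /andP[sBX _].
  by split.
Qed.

(* Witnessed by the complete 3-graph on [3 s + 2] vertices. *)
Lemma admissible3_exists s :
  exists (n : nat) (F : {set {set 'I_n}}), admissible 3 s F.
Proof.
pose F := [set A : {set 'I_(3 * s + 2)} | #|A| == 3]; exists (3 * s + 2), F.
have F3 : kgraph 3 F by apply/forall_inP=> A; rewrite inE.
(* The [3 * s + 2] vertices cannot hold [s + 1] disjoint triples, but the [3 * s] left after
   deleting two still hold [s]. *)
have nu_le : matching_number F <= s.
  have [M [sMF tM <-]] := maximum_matching F.
  have := max_card (mem (cover M)).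
  by rewrite (card_cover_matching F3 sMF tM) card_ord; lia.
have nu_av (T : {set 'I_(3 * s + 2)}) : #|T| <= 2 -> matching_number (avoiding F T) = s.
  move=> T2; apply/eqP; rewrite eqn_leq; apply/andP; split.
    apply: leq_trans nu_le; have [M [sM tM <-]] := maximum_matching (avoiding F T).
    apply: matching_le tM; apply: subset_trans sM _.
    by apply/subsetP=> A; rewrite inE => /andP[].
  have [|M [tM cM hM]] := @matching_of_triples _ s (~: T).
    by rewrite cardsCs setCK card_ord; lia.
  rewrite -[leqLHS]cM; apply: matching_le tM; apply/subsetP=> A /hM[A3 sA].
  by rewrite !inE A3 eqxx disjoints_subset.
have nuF : matching_number F = s.
  rewrite -[RHS](nu_av set0) ?cards0 //; congr matching_number; apply/setP=> A.
  by rewrite !inE disjoint_sym disjoints_subset sub0set andbT.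
by split=> // T T2; rewrite nu_av.
Qed.

(** Passing to a larger value shrinks the gap to [b]; excluded middle decides whether one exists. *)
Lemma maximum_exists (P : nat -> Prop) b : (exists v, P v) -> (forall v, P v -> v <= b) ->
  exists v, P v /\ forall w, P w -> w <= v.
Proof.
move=> [v0 Pv0] leb; have [k] := ubnP (b - v0); elim: k v0 Pv0 => // k IH v Pv hk.
have [[w [Pw vw]]|no] := classic (exists w, P w /\ v < w).
  by apply: (IH w) => //; have := leb w Pw; lia.
exists v; split=> // w Pw; rewrite leqNgt; apply/negP=> vw; apply: no.
by exists w.
Qed.

Lemma is_m3_exists s : 3 <= s -> exists v, is_m 3 s v.
Proof.
move=> s3; pose P v := exists (n : nat) (F : {set {set 'I_n}}), admissible 3 s F /\ #|F| = v.
(* Any bound will do here, so the one on [6 * #|F|] is applied to [#|F|]. *)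
have [||v [Pv maxv]] := @maximum_exists P (73 * s ^ 3 + 300).
- by have [n [F aF]] := admissible3_exists s; exists #|F|, n, F.
- move=> _ [n [F [/(admissible3_bound s3)[hF _] <-]]].
  by apply: leq_trans hF; rewrite leq_pmull.
by exists v; split=> // n F aF; apply: maxv; exists n, F.
Qed.

(** * Passage to rational numbers, where division by 6 turns 300 into 50 *)

Import Order.TTheory GRing.Theory Num.Theory.
Local Open Scope ring_scope.

Theorem theorem1p9 :
  (forall s : nat, (3 <= s)%N ->
     exists v : nat, is_m 3 s v /\
       (v%:R <= (73%:R / 6%:R) * s%:R ^+ 3 + 50%:R :> rat)) /\
  (forall s : nat, (21 <= s)%N ->
     exists v : nat, is_m 3 s v /\
       (v%:R <= (73%:R / 6%:R) * s%:R ^+ 3 :> rat)).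
Proof.
split=> s hs; have s3 : (3 <= s)%N by [exact: hs|apply: leq_trans hs].
  have [v mv] := is_m3_exists s3; exists v; split; first exact: mv.
  have [[n [F [aF <-]]] _] := mv; have [hF _] := admissible3_bound s3 aF.
  by move: hF; rewrite -(ler_nat rat) natrD (natrM _ 6) (natrM _ 73) natrX; lra.
have [v mv] := is_m3_exists s3; exists v; split; first exact: mv.
have [[n [F [aF <-]]] _] := mv; have [_ /(_ hs) hF] := admissible3_bound s3 aF.
by move: hF; rewrite -(ler_nat rat) (natrM _ 6) (natrM _ 73) natrX; lra.
Qed.
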